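(* Let $\mathbf{S}\in\mathbb{R}^{N\times N}$ be the symmetric graph matrix description of an undirected graph with $N$ nodes, with distinct eigenvalues $\lambda_1,\dots,\lambda_N$ and eigendecomposition $\mathbf{S}=\mathbf{V}\,\mathrm{diag}(\lambda_1,\dots,\lambda_N)\,\mathbf{V}^{T}$, $\mathbf{V}$ orthogonal. Let $\mathbf{x}\in\mathbb{R}^N$, let $\mathbf{H}\in\mathbb{R}^{N\times(K+1)}$ be an arbitrary matrix of filter taps whose $(k+1)$-th column is $\mathbf{h}^{(k)}\in\mathbb{R}^N$, $k=0,\dots,K$, and let $$\mathbf{y}=\sum_{k=0}^{K}\mathrm{diag}(\mathbf{h}^{(k)})\,\mathbf{S}^{k}\,\mathbf{x}$$ be the output of the corresponding node-variant graph filter. Then the frequency response $\tilde{\mathbf{y}}=\mathbf{V}^{T}\mathbf{y}$ of the output is given by $$\tilde{\mathbf{y}}=\mathbf{V}^{T}\big(\mathbf{V}\circ(\mathbf{H}\boldsymbol{\Lambda}^{T})\big)\tilde{\mathbf{x}},$$ where $\tilde{\mathbf{x}}=\mathbf{V}^{T}\mathbf{x}$, $\circ$ denotes the elementwise product of matrices, and $\boldsymbol{\Lambda}\in\mathbb{R}^{N\times(K+1)}$ is the Vandermonde matrix with entries $[\boldsymbol{\Lambda}]_{ik}=\lambda_i^{k-1}$.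
   Context: A graph matrix description (GMD) of a graph with nodes $v_1,\dots,v_N$ and edge set $\mathcal{E}$ is a matrix $\mathbf{S}\in\mathbb{R}^{N\times N}$ with $[\mathbf{S}]_{ij}=0$ for all distinct $i,j$ such that $(v_j,v_i)\notin\mathcal{E}$. Since the graph is undirected, $\mathbf{S}$ is assumed symmetric; its eigenvalues are assumed distinct throughout, and the columns $\mathbf{v}_i$ of $\mathbf{V}$ form an orthonormal basis of eigenvectors, $\mathbf{S}\mathbf{v}_i=\lambda_i\mathbf{v}_i$. A graph signal is a vector $\mathbf{x}\in\mathbb{R}^N$; its frequency response (graph Fourier transform) is $\tilde{\mathbf{x}}=\mathbf{V}^{T}\mathbf{x}$. For a vector $\mathbf{a}$, $\mathrm{diag}(\mathbf{a})$ is the diagonal matrix with $\mathbf{a}$ on its diagonal. The node-variant graph filter (NVGF) with filter taps $\mathbf{H}$ is the linear map $\mathbf{x}\mapsto\sum_{k=0}^{K}\mathrm{diag}(\mathbf{h}^{(k)})\mathbf{S}^k\mathbf{x}$. *)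

(* Defs.v *)
From mathcomp Require Import all_boot all_order all_algebra.
From mathcomp Require Import reals.

Set Implicit Arguments.
Unset Strict Implicit.
Unset Printing Implicit Defensive.

Import GRing.Theory.
Local Open Scope ring_scope.

(* The graph has node set 'I_N, and [e j i] means that (v_j, v_i) is an edge;
   note the order of the indices with respect to the entry [S i j]. *)
Definition graph_matrix_description (R : realType) (N : nat)
    (e : rel 'I_N) (S : 'M[R]_N) : Prop :=
  forall i j : 'I_N, i != j -> ~~ e j i -> S i j = 0.

Definition orthogonal_mx (R : realType) (N : nat) (V : 'M[R]_N) : Prop :=
  V^T *m V = 1%:M.

Definition hadamard (R : realType) (m n : nat) (A B : 'M[R]_(m, n)) :
    'M[R]_(m, n) :=
  map2_mx *%R A B.

(* Graph Fourier transform in the eigenvector basis given by the columns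
   of V. *)
Definition gft (R : realType) (N : nat) (V : 'M[R]_N) (x : 'cV[R]_N) :
    'cV[R]_N :=
  V^T *m x.

(* Node-variant graph filter. Column k of H (counted from 0) is h^(k); it is
   transposed only because [diag_mx] expects a row vector. *)
Definition nvgf (R : realType) (N K : nat) (S : 'M[R]_N)
    (H : 'M[R]_(N, K.+1)) (x : 'cV[R]_N) : 'cV[R]_N :=
  \sum_(k < K.+1) diag_mx (col k H)^T *m (S ^+ k) *m x.

(* N x (K+1) matrix with entries lam_i ^ k for 0 <= k <= K. The library's
   [Vandermonde] has the powers along its rows, hence the transpose. *)
Definition gmd_vandermonde (R : realType) (N K : nat) (lam : 'rV[R]_N) :
    'M[R]_(N, K.+1) :=
  (Vandermonde K.+1 lam)^T.

(* Main.v *)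
Require Import Defs.
From mathcomp Require Import all_boot all_order all_algebra.
From mathcomp Require Import reals.

Import GRing.Theory.
Local Open Scope ring_scope.

(** Powers of [S] are diagonal in the basis [V], so entry [i] of [S ^+ k *m x] is the sum over [j]
    of [V i j * lam 0 j ^+ k] times the [j]-th frequency coefficient of [x]. The taps scale row [i]
    by [H i k]; summing over [k] first turns the coefficient at [j] into [V i j] times the
    polynomial with coefficients [H i k] evaluated at [lam 0 j], an entry of the Hadamard
    product. *)

Lemma expr_orthogonal_diag (R : realType) (N k : nat) (V : 'M[R]_N)
    (lam : 'rV[R]_N) :
  orthogonal_mx V ->
  (V *m diag_mx lam *m V^T) ^+ k
    = V *m diag_mx (\row_j lam 0 j ^+ k) *m V^T.
Proof.
move=> V_orth; elim: k => [|k IHk].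
  have -> : \row_j lam 0 j ^+ 0 = const_mx 1 :> 'rV[R]_N.
    by apply/rowP => j; rewrite !mxE.
  (* The base case needs [V *m V^T = 1]; for square matrices a left inverse is also a right
     inverse. *)
  by rewrite diag_const_mx mulmx1 (mulmx1C V_orth).
rewrite exprS IHk -mulmxE !mulmxA -(mulmxA _ V^T V) V_orth mulmx1.
rewrite -(mulmxA V) mulmx_diag; congr (_ *m diag_mx _ *m _).
by apply/rowP => j; rewrite !mxE exprS.
Qed.

Theorem proposition1 (R : realType) (N K : nat) (e : rel 'I_N)
    (S V : 'M[R]_N) (lam : 'rV[R]_N) (x y : 'cV[R]_N) (H : 'M[R]_(N, K.+1))
    (e_sym : symmetric e)
    (S_gmd : graph_matrix_description e S)
    (S_sym : S^T = S)
    (lam_distinct : injective (fun i : 'I_N => lam 0 i))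
    (V_orth : orthogonal_mx V)
    (S_eig : S = V *m diag_mx lam *m V^T)
    (y_def : y = nvgf S H x) :
  gft V y = V^T *m hadamard V (H *m (gmd_vandermonde K lam)^T) *m gft V x.
Proof.
rewrite y_def /nvgf {1}/gft -mulmxA; congr (_ *m _).
apply/colP => i; rewrite summxE mxE.
(* The outer [V^T] is gone, so the node-domain outputs are compared at node [i], expanded over taps
   and frequencies. *)
transitivity (\sum_(k < K.+1) \sum_j
    H i k * (V i j * lam 0 j ^+ k) * gft V x j 0).
  apply: eq_bigr => k _.
  rewrite S_eig expr_orthogonal_diag // -!mulmxA (mulmxA V) mul_diag_mx.
  rewrite mxE [X in _ * X]mxE mulr_sumr; apply: eq_bigr => j _.
  by rewrite mul_mx_diag !mxE mulrA.
rewrite exchange_big; apply: eq_bigr => j _ /=.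
(* The transpose inside [gmd_vandermonde] cancels the outer one, leaving [Vandermonde], whose entry
   at [k], [j] is [lam 0 j ^+ k]. *)
rewrite trmxK -mulr_suml !mxE; congr (_ * _).
rewrite mulr_sumr; apply: eq_bigr => k _.
by rewrite !mxE mulrCA.
Qed.
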